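(* Suppose $\lambda$ is the inverse of a Pisot number, and let $\mu$ be the invariant measure of the IFS on $\mathbb{R}$ given by $\tau_0(x)=\lambda x$, $\tau_1(x)=\lambda(x+1)$ (equal weights $1/2$), i.e. of the system $(A,B)$ with $A=\lambda^{-1}$ and $B=\{0,1\}$. Then $\mu$ is chaotic.
   Context: A Pisot number is an irrational algebraic integer $\alpha>1$ (real) all of whose Galois conjugates other than $\alpha$ itself have modulus less than $1$. The invariant measure of a system $(A,B)$, with $B$ finite and maps $\tau_b(x)=A^{-1}(x+b)$, $b\in B$, is the unique Borel probability measure $\mu$ with $\mu=\frac1{\#B}\sum_{b\in B}\mu\circ\tau_b^{-1}$. For $B=\{b_i\}$ and a translation parameter $t$, let $B_t=\{b_i+At\}$ and let $\mu^{(t)}$ denote the invariant measure of the system $(A,B_t)$. The measure $\mu^{(0)}$ (the invariant measure of $(A,B)$) is called chaotic if there exist a sequence $t_n\to0$ and a number $\varepsilon>0$ such that $\|\mu^{(t_n)}-\mu^{(0)}\|\ge\varepsilon$ for all $n$, where $\|\cdot\|$ is the total variation norm. *)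

(* Defs.v *)
From HB Require Import structures.
From mathcomp Require Import all_boot all_order all_algebra.
From mathcomp Require Import complex finmap.
From mathcomp Require Import all_classical all_reals all_analysis.
Set Implicit Arguments.
Unset Strict Implicit.
Unset Printing Implicit Defensive.
Import Order.TTheory GRing.Theory Num.Theory.
Import numFieldNormedType.Exports.
Local Open Scope classical_set_scope.
Local Open Scope fset_scope.
Local Open Scope ring_scope.

Section Pisot.
Variable R : realType.

Definition is_minimal_polynomial (a : R) (p : {poly rat}) : Prop :=
  [/\ p \is monic, irreducible_poly p & root (map_poly ratr p) a].

Definition galois_conjugate (a : R) (z : R[i]) : Prop :=
  exists2 p, is_minimal_polynomial a p & root (map_poly ratr p) z.

Definition pisot (a : R) : Prop :=
  [/\ 1 < a, irrational a, integralOver (intr : int -> R) a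
    & forall z : R[i], galois_conjugate a z -> z != a%:C%C -> `|z| < 1].

End Pisot.

Section InvariantMeasure.
Variable R : realType.
Implicit Types (A t : R) (B : {fset R}).

Local Notation borel_probability := (probability (measurableTypeR R) R).

Definition tau A (b x : R) : R := A^-1 * (x + b).

Definition is_invariant_measure A B (mu : borel_probability) : Prop :=
  forall E : set (measurableTypeR R), measurable E ->
    (mu E = ((#|` B|%:R)^-1)%:E * \sum_(b <- B) pushforward mu (tau A b) E)%E.

(* The Dirac mass at 0 is a junk value, returned only for systems that have no
   invariant measure; a system with `|A| > 1 and B nonempty has exactly one. *)
Definition invariant_measure A B : borel_probability :=
  xget (dirac (0 : measurableTypeR R) : borel_probability)
    [set mu | is_invariant_measure A B mu].

Definition translated_digits A B t : {fset R} := [fset b + A * t | b in B].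

(* The total variation |nu|(T) = nu^+(T) + nu^-(T); it does not depend on the
   Hahn decomposition chosen. *)
Definition tv_norm d (T : measurableType d)
    (nu : {charge set T -> \bar R}) : \bar R :=
  let hahn := projT2 (cid (projT2 (cid (Hahn_decomposition nu)))) in
  charge_variation hahn [set: T].

Definition tv_dist d (T : measurableType d) (mu nu : probability T R) :
    \bar R :=
  tv_norm (cadd (charge_of_finite_measure mu)
                (copp (charge_of_finite_measure nu))).

Definition chaotic A B : Prop :=
  exists (t : R^nat) (e : R),
    [/\ t @ \oo --> (0 : R), 0 < e
      & forall n, (e%:E <= tv_dist
            (invariant_measure A (translated_digits A B (t n)))
            (invariant_measure A B))%E].

End InvariantMeasure.

(* Main.v *)
(* Write F_t(xi) for the integral of cos (xi (x - c_t)) against mu^(t), where c_t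
   is the centre of symmetry of mu^(t). Self-similarity gives
   F_t(xi) = cos (xi / (2 alpha)) F_t(xi / alpha), and F_t is continuous at 0
   with F_t(0) = 1, so F_t = F does not depend on t. For xi_n = 2 pi alpha^n and
   t_n = (alpha - 1) / (2 alpha^(n+1)) one has xi_n (c_(t_n) - c_0) = pi: the
   function cos (xi_n (x - c_0)) has integral F(xi_n) against mu^(0) and - F(xi_n)
   against mu^(t_n), so the total variation distance is at least 2 |F(xi_n)|.
   As observed by Erdos, |F(xi_n)| = |F(2 pi)| prod_(j < n) |cos (pi alpha^j)| is
   bounded away from 0: alpha^j is exponentially close to an integer, and it is
   irrational for j > 0. *)
From HB Require Import structures.
Require Import Defs.
From mathcomp Require Import all_boot all_order all_algebra finmap.
From mathcomp Require Import complex.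
From mathcomp Require Import all_classical all_reals all_analysis.
From mathcomp Require Import measurable_realfun.
From mathcomp Require Import lra ring.
Set Implicit Arguments.
Unset Strict Implicit.
Unset Printing Implicit Defensive.
Import Order.TTheory GRing.Theory Num.Theory.
Import numFieldNormedType.Exports.
Local Open Scope fset_scope.
Local Open Scope classical_set_scope.
Local Open Scope ring_scope.

(** * Pisot numbers *)

Section PowerSums.
Variable F : comNzRingType.
Implicit Types (z : F) (s : seq F).

Let rootprod s : {poly F} := \prod_(z <- s) ('X - z%:P).

(* [weighted j s] is the sum over z in s of z^j * prod_(w != z) ('X - w). *)
Let Fixpoint weighted j s : {poly F} :=
  if s is z :: s' then
    z ^+ j *: rootprod s' + ('X - z%:P) * weighted j s'
  else 0.

Let deriv_rootprod s : (rootprod s)^`() = weighted 0 s.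
Proof.
rewrite /rootprod; elim: s => [|z s IH]; first by rewrite big_nil derivC.
by rewrite big_cons derivM derivXsubC mul1r IH /= expr0 scale1r.
Qed.

(** Writing z = 'X - ('X - z) in the summand of z turns the extra factor z into 'X, at the cost of
    z^j times the full product. *)
Let weightedS j s :
  weighted j.+1 s = 'X * weighted j s - (\sum_(z <- s) z ^+ j) *: rootprod s.
Proof.
elim: s => [|z s IH] /=; first by rewrite big_nil scale0r subr0 mulr0.
rewrite IH /rootprod !big_cons -!mul_polyC exprS polyCM polyCD; ring.
Qed.

Let size_weighted j s : (size (weighted j s) <= size s)%N.
Proof.
elim: s => [|z s IH] /=; first by rewrite size_poly0.
rewrite (leq_trans (size_polyD _ _))// geq_max.
rewrite (leq_trans (size_scale_leq _ _)) ?size_prod_XsubC//=.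
by rewrite (leq_trans (size_polyMleq _ _))// size_XsubC.
Qed.

(** In [weightedS], the left side has degree below [size s], while the root product is monic of
    degree [size s]; comparing coefficients there isolates the power sum. *)
Let power_sum_coef j s :
  \sum_(z <- s) z ^+ j = ('X * weighted j s)`_(size s).
Proof.
have /eqP := weightedS j s; rewrite eq_sym subr_eq => /eqP ->.
rewrite coefD nth_default ?size_weighted// add0r coefZ.
have /monicP := monic_prod_XsubC s xpredT id.
by rewrite lead_coefE size_prod_XsubC => ->; rewrite mulr1.
Qed.

(** Integrality propagates along [weightedS]: it starts at the derivative of p, and each step uses
    only p, 'X and one integer coefficient. *)
Lemma power_sum_int (p : {poly int}) s (n : nat) :
  map_poly intr p = \prod_(z <- s) ('X - z%:P) ->
  exists c : int, \sum_(z <- s) z ^+ n = c%:~R.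
Proof.
move=> ps.
suff [q qE] : exists q : {poly int}, map_poly intr q = weighted n s.
  exists ('X * q)`_(size s).
  by rewrite power_sum_coef -qE -[in LHS](map_polyX intr) -rmorphM /= coef_map.
elim: n => [|n [q qE]].
  by exists p^`(); rewrite -deriv_map ps deriv_rootprod.
exists ('X * q - ('X * q)`_(size s) *: p).
rewrite weightedS power_sum_coef -qE rmorphB /= map_polyZ /= ps.
by rewrite -[in RHS](map_polyX intr) -rmorphM /= coef_map.
Qed.
End PowerSums.

(** * Integral minimal polynomials and separability *)

Section MinimalPolynomial.
Variable R : realType.

(** A monic integer polynomial of least degree vanishing at a is irreducible over the rationals: by
    Gauss's lemma a rational factor comes from an integer one, and a factorization g h of a monic
    polynomial has unit leading coefficients, so the factor vanishing at a has full degree. *)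
Lemma integral_minimal_polynomial (a : R) :
  integralOver (intr : int -> R) a ->
  exists2 p : {poly int}, p \is monic &
    is_minimal_polynomial a (map_poly intr p).
Proof.
move=> [p0 p0m p0a].
have comp (q : {poly int}) :
    map_poly ratr (map_poly (intr : int -> rat) q) = map_poly intr q :> {poly R}.
  by rewrite -map_poly_comp; apply: eq_map_poly => c /=; rewrite ratr_int.
have : exists n, `[< exists q : {poly int},
    [/\ q \is monic, root (map_poly intr q) a & size q = n] >].
  by exists (size p0); apply/asboolP; exists p0.
case/ex_minnP => n /asboolP[p [pm pa szp]] nmin.
have min (q : {poly int}) :
  lead_coef q \is a GRing.unit -> root (map_poly intr q : {poly R}) a ->
  (size p <= size q)%N.
  move=> qu qa; rewrite szp.
  have u0 : (lead_coef q)^-1 != 0.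
    by apply: contraTneq qu => /(congr1 GRing.inv); rewrite invrK invr0 => ->.
  rewrite -(size_scale _ u0); apply: nmin; apply/asboolP.
  exists ((lead_coef q)^-1 *: q); split=> //.
    by rewrite monicE lead_coefZ mulVr.
  by rewrite map_polyZ /= rootZ// intr_eq0.
exists p => //; split.
- exact: monic_map.
- split.
    rewrite size_rat_int_poly ltnNge; apply/negP => /size1_polyC pC.
    move: pa; rewrite pC map_polyC /= rootC intr_eq0 => /eqP p00.
    by move: pm; rewrite pC p00 monicE lead_coef0 eq_sym oner_eq0.
  move=> f + /dvdpP_rat_int[g [c c0 fE]] [h pE].
  rewrite fE size_scale// size_rat_int_poly => g1.
  have /eqP lgh : lead_coef g * lead_coef h == 1.
    by rewrite -lead_coefM -pE -monicE.
  have gu : lead_coef g \is a GRing.unit.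
    by apply/unitrP; exists (lead_coef h); split; rewrite // mulrC.
  have hu : lead_coef h \is a GRing.unit.
    by apply/unitrP; exists (lead_coef g); split; rewrite // mulrC.
  have g0 : g != 0.
    by apply: contraTneq gu => ->; rewrite lead_coef0 unitr0.
  have h0 : h != 0.
    by apply: contraTneq hu => ->; rewrite lead_coef0 unitr0.
  have sz : size p = (size g + size h).-1 by rewrite pE size_mul.
  apply: (eqp_trans (eqp_scale _ c0)).
  rewrite -dvdp_size_eqp ?dvdp_rat_int ?pE ?dvdp_mulIl// -pE !size_rat_int_poly.
  have : root (map_poly intr (g * h) : {poly R}) a by rewrite -pE.
  rewrite rmorphM /= rootM => /orP[ga|ha].
    rewrite eqn_leq min// andbT sz; move: h0; rewrite -size_poly_gt0.
    by case: (size h) => // k _; rewrite addnS leq_addr.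
  have := min _ hu ha; rewrite sz; move: g0 g1; rewrite -size_poly_gt0.
  by case: (size g) => [|[|k]] // _ _; rewrite addSn /= addSn ltnNge leq_addl.
- by rewrite comp.
Qed.

End MinimalPolynomial.

(** In characteristic zero the derivative is nonzero and of smaller degree, so p cannot divide
    it. *)
Lemma irreducible_coprime_deriv (F : realFieldType) (p : {poly F}) :
  irreducible_poly p -> coprimep p p^`().
Proof.
move=> pirr; have [p1 _] := pirr; rewrite irreducible_poly_coprime//.
apply/negP => /dvdp_leq; rewrite -size_poly_gt0 polyorder.size_deriv => le.
by move: p1 le; case: (size p) => [|[|n]] // _ /(_ isT); rewrite ltnn.
Qed.

(** * Powers of a Pisot number: irrationality and distance to the integers *)

Section Pisot.
Variables (R : realType) (alpha : R).
Hypothesis alpha_pisot : pisot alpha.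

Let alpha_gt1 : 1 < alpha. Proof. by case: alpha_pisot. Qed.

Let ratr_intr (q : {poly int}) (F : numFieldType) :
  map_poly ratr (map_poly (intr : int -> rat) q) = map_poly intr q :> {poly F}.
Proof.
by rewrite -map_poly_comp; apply: eq_map_poly => c /=; rewrite ratr_int.
Qed.

Let map_ratr_complex (q : {poly rat}) :
  map_poly ratr q = map_poly (real_complex R) (map_poly ratr q) :> {poly R[i]}.
Proof.
by rewrite -map_poly_comp; apply: eq_map_poly => c /=; rewrite fmorph_rat.
Qed.

Lemma pisot_conjugates : exists (p : {poly int}) (s : seq R[i]),
  [/\ irreducible_poly (map_poly (intr : int -> rat) p),
      map_poly intr p = \prod_(z <- alpha%:C%C :: s) ('X - z%:P),
      (0 < size s)%N
    & forall z, z \in s -> `|z| < 1].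
Proof.
case: alpha_pisot => _ irr aint conj.
have [p pm pmin] := integral_minimal_polynomial aint.
have [_ pirr pa] := pmin.
set P : {poly R[i]} := map_poly intr p.
have PE : P = map_poly ratr (map_poly (intr : int -> rat) p).
  by rewrite ratr_intr.
have Pa : root P alpha%:C%C by rewrite PE map_ratr_complex fmorph_root.
have [r] := closed_field_poly_normal P.
have /monicP -> : P \is monic by exact: monic_map.
rewrite scale1r => Pr.
have ar : alpha%:C%C \in r by rewrite -root_prod_XsubC -Pr.
have {}Pr : P = \prod_(z <- alpha%:C%C :: rem alpha%:C%C r) ('X - z%:P).
  by rewrite Pr; apply: perm_big; exact: perm_to_rem.
move: (rem _ _) Pr => s Pr {r ar}.
have sz : size (map_poly (intr : int -> rat) p) = (size s).+2.
  by rewrite size_rat_int_poly -(size_map_inj_poly (f := intr : int -> R[i])) //;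
    [rewrite -/P Pr size_prod_XsubC | exact: intr_inj].
exists p, s; split=> //.
(* Without other conjugates p would have degree 1 and [alpha] would be rational. *)
- rewrite lt0n; apply/negP => /eqP s0; apply: irr.
  rewrite s0 in sz; have p1 : p`_1 = 1.
    by move/monicP: pm; rewrite lead_coefE -size_rat_int_poly sz.
  exists (- (p`_0)%:~R) => //.
  move: pa; rewrite rootE horner_coef size_map_poly sz !big_ord_recr big_ord0 /=.
  rewrite !coef_map /= p1 rmorph1 expr0 expr1 add0r mulr1 mul1r addrC addr_eq0.
  by rewrite rmorphN => /eqP ->.
- move=> z zs; apply: conj.
    exists (map_poly intr p) => //.
    by rewrite -PE Pr root_prod_XsubC in_cons zs orbT.
  (* If [alpha] occurred again in s, it would be a double root of P, hence a common root of P and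
     its derivative. *)
  apply: contraTneq zs => ->; rewrite -root_prod_XsubC.
  have := irreducible_coprime_deriv pirr.
  rewrite -(coprimep_map (ratr : rat -> R[i])) -deriv_map -PE.
  move=> cop; apply: contraNN (coprimep_root cop Pa) => sa.
  rewrite Pr big_cons derivM derivXsubC mul1r hornerD hornerM hornerXsubC subrr.
  by rewrite mul0r addr0.
Qed.

(** If alpha^n were a rational r, the minimal polynomial would divide 'X^n - r, and every conjugate
    would have modulus [alpha] > 1. *)
Lemma pisot_pow_irrational (n : nat) : (0 < n)%N -> irrational (alpha ^+ n).
Proof.
move=> n0; have [p [s [pirr ps s0 slt]]] := pisot_conjugates.
case=> r _ rE.
have pX : map_poly intr p %| 'X^n - r%:P.
  rewrite -[_ %| _]negbK -irreducible_poly_coprime//; apply/negP.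
  rewrite -(coprimep_map (ratr : rat -> R[i])) ratr_intr.
  move=> /coprimep_root cop.
  have /cop/eqP : root (map_poly intr p) alpha%:C%C.
    by rewrite ps root_prod_XsubC mem_head.
  apply.
  rewrite rmorphB /= map_polyXn map_polyC /= hornerD hornerN hornerC hornerXn.
  by rewrite -[ratr r](fmorph_rat (real_complex R)) rE -rmorphXn /= subrr.
have [z zs] : exists z, z \in s.
  by case: s s0 {ps slt} => // z s _; exists z; rewrite mem_head.
have : root ('X^n - (alpha ^+ n)%:C%C%:P) z.
  have : map_poly (ratr : rat -> R[i]) (map_poly intr p) %| 
      map_poly ratr ('X^n - r%:P) by rewrite dvdp_map.
  rewrite rmorphB /= map_polyXn map_polyC /= ratr_intr ps => dv.
  rewrite -dvdp_XsubCl.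
  suff : 'X - z%:P %| 'X^n - (ratr r)%:P.
    by rewrite -[ratr r](fmorph_rat (real_complex R)) rE.
  by apply: dvdp_trans dv; rewrite dvdp_XsubCl root_prod_XsubC in_cons zs orbT.
rewrite rootE hornerD hornerN hornerC hornerXn subr_eq0 => /eqP/(congr1 Num.norm).
rewrite normrX => zE.
have aC : `|alpha%:C%C| = alpha%:C%C.
  by rewrite ger0_norm// ler0c ltW// (lt_trans ltr01).
have : `|z| ^+ n < 1 by rewrite exprn_ilt1 ?normr_ge0 ?slt ?lt0n_neq0.
rewrite zE rmorphXn normrX aC -rmorphXn -[1]/(1%:C%C) ltcR.
by rewrite ltNge exprn_ege1// ltW.
Qed.

(** The integer is the n-th power sum of all conjugates; the error is the power sum of those other
    than [alpha], with r their largest modulus and C their number. *)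
Lemma pisot_pow_near_int : exists C r : R, [/\ 0 <= C, 0 <= r < 1 &
  forall n, exists c : int, `|alpha ^+ n - c%:~R| <= C * r ^+ n].
Proof.
have [p [s [pirr ps s0 slt]]] := pisot_conjugates.
pose r := \big[Num.max/0]_(z <- s) complex.Re `|z|.
have rle z : z \in s -> `|z| <= r%:C%C.
  move=> zs; rewrite normc_def lecR.
  have -> : Num.sqrt ((complex.Re z) ^+ 2 + (complex.Im z) ^+ 2) = complex.Re `|z|.
    by rewrite normc_def.
  exact: (@le_bigmax_seq _ _ _ _ 0 _ xpredT (fun z => complex.Re `|z|) zs).
exists (size s)%:R, r; split=> //.
  apply/andP; split; first exact: bigmax_ge_id.
  rewrite /r big_seq; apply: bigmax_lt => // z zs.
  by rewrite -ltcR; have := slt z zs; rewrite normc_def.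
move=> n; have [c cE] := power_sum_int n ps.
exists c; rewrite -lecR.
have -> : `|alpha ^+ n - c%:~R|%:C%C = `|\sum_(z <- s) z ^+ n|.
  have -> : \sum_(z <- s) z ^+ n = (c%:~R - alpha ^+ n)%:C%C.
    by rewrite rmorphB rmorph_int -cE big_cons rmorphXn /= addrC addKr.
  by rewrite distrC normc_def /= expr0n addr0 sqrtr_sqr.
rewrite (le_trans (ler_norm_sum _ _ _))//.
have -> : ((size s)%:R * r ^+ n)%:C%C = \sum_(z <- s) r%:C%C ^+ n.
  rewrite big_const_seq count_predT iter_addr_0 -[RHS]mulr_natl.
  by rewrite rmorphM rmorph_nat rmorphXn.
rewrite big_seq_cond [leRHS]big_seq_cond; apply: ler_sum => z /andP[zs _].
by rewrite normrX lerXn2r ?nnegrE ?normr_ge0 ?rle// (le_trans _ (rle z zs)).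
Qed.
End Pisot.

(** * Products of cosines *)

Section Cosine.
Variable R : realType.
Implicit Types x y : R.

Lemma norm_cosDpin x (n : nat) : `|cos (x + n%:R * pi)| = `|cos x|.
Proof.
elim: n => [|n IH]; first by rewrite mul0r addr0.
by rewrite -addn1 natrD mulrDl mul1r addrA cosDpi normrN.
Qed.

Lemma norm_cosDpiz x (k : int) : `|cos (x + k%:~R * pi)| = `|cos x|.
Proof.
case: k => n; first exact: norm_cosDpin.
rewrite NegzE -[in RHS](subrK (n.+1%:R * pi) x) norm_cosDpin.
by rewrite rmorphN mulNr.
Qed.

(** Removing the integer part brings pi x into [0, pi[, where cosine is injective and vanishes only
    at pi / 2; a zero thus forces x to be a half-integer. *)
Lemma cos_pi_neq0 x : irrational x -> cos (pi * x) != 0.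
Proof.
apply: contra_not_neq => cos0.
pose k := Num.floor x; pose y := x - k%:~R.
have y01 : 0 <= y < 1.
  rewrite /y subr_ge0 floor_le ltrBlDr; have := floorD1_gt x.
  by rewrite intrD addrC.
have cosy : cos (pi * y) = cos (pi / 2).
  apply/eqP; rewrite cos_pihalf -normr_eq0 -(norm_cosDpiz _ k) /y.
  by rewrite mulrBr (mulrC k%:~R) subrK normr_eq0 cos0.
have pi0 := @pi_gt0 R.
have /(mulfI (lt0r_neq0 pi0)) y2 : pi * y = pi / 2.
  apply: cos_inj cosy; rewrite in_itv /=; apply/andP; split; nra.
exists (k%:~R + 2^-1) => //.
by rewrite rmorphD fmorphV /= ratr_int ratr_nat -y2 /y addrC subrK.
Qed.

(** By the mean value theorem on [0, |x|], cosine drops at most at unit speed from its value 1. *)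
Lemma norm_cos_ge x : 1 - `|x| <= `|cos x|.
Proof.
rewrite -(cos_norm x); move: (normr_ge0 x); set y := `|x|; move: y => {}x.
rewrite le_eqVlt => /predU1P[<-|x0]; first by rewrite cos0 subr0 normr1.
have [] := @MVT R cos (fun y => - sin y) 0 x x0.
  exact/continuous_subspaceT/continuous_cos.
move=> y yx; rewrite cos0 subr0 => E.
rewrite (le_trans _ (ler_norm _))//.
have := sin_le1 y; move: E; nra.
Qed.

End Cosine.

(* The tail of the product is at least 1 minus the sum of the [1 - a j]. *)
Lemma prod_lower_bound (R : realType) (a : nat -> R) (C r : R) :
  0 <= C -> 0 <= r < 1 -> (forall j, 0 < a j <= 1) ->
  (forall j, 1 - a j <= C * r ^+ j) ->
  exists2 c, 0 < c & forall n, c <= \prod_(j < n) a j.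
Proof.
move=> C0 /andP[r0 r1] a01 aC.
have r1' : 0 < 1 - r by rewrite subr_gt0.
(* N makes the whole geometric tail at most 1/2, so the factors past N cost at most a factor 2. *)
have [N CN] : exists N, C / (1 - r) * r ^+ N <= 2^-1.
  have : (fun N => C / (1 - r) * r ^+ N) @ \oo --> C / (1 - r) * 0.
    by apply: cvgMr; apply: cvg_expr; rewrite ger0_norm.
  rewrite mulr0 => /cvgrPdist_le/(_ 2^-1)/(_ _)[]; first by rewrite invr_gt0.
  move=> N _ /(_ N (leqnn N)); rewrite /= sub0r normrN => h.
  by exists N; rewrite (le_trans (ler_norm _)).
set P := \prod_(j < N) a j.
have P0 : 0 < P by apply: prodr_gt0 => j _; case/andP: (a01 j).
exists (P / 2) => [|n]; first by rewrite divr_gt0.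
have [nN|Nn] := leqP n N.
  have : P <= \prod_(j < n) a j.
    rewrite /P -(subnKC nN) big_split_ord /= ler_piMr ?prodr_ge0//.
      by move=> j _; case/andP: (a01 j) => /ltW.
    by apply: prodr_ile1 => j _; case/andP: (a01 (n + j)%N) => /ltW -> ->.
  by apply: le_trans; rewrite ler_pdivrMr// ler_peMr ?(ltW P0)// ler1n.
rewrite -(subnKC (ltnW Nn)); move: (n - N)%N => k {n Nn}.
have pos m : 0 <= C / (1 - r) * r ^+ m.
  by rewrite mulr_ge0 ?exprn_ge0// divr_ge0// ltW.
(* The subtracted term is the geometric sum of C r^j for N <= j < N + k; keeping it exact lets the
   induction close. *)
suff : P * (1 - C / (1 - r) * (r ^+ N - r ^+ (N + k))) <= \prod_(j < N + k) a j.
  apply: le_trans; rewrite ler_pM2l//.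
  by move: (pos (N + k)%N) CN; set u := C / _; nra.
elim: k => [|k IH]; first by rewrite addn0 subrr mulr0 subr0 mulr1.
rewrite addnS big_ord_recr /=.
have [ak0 ak1] := andP (a01 (N + k)%N).
apply: le_trans (ler_wpM2r (ltW ak0) IH).
have vu : C / (1 - r) * r ^+ (N + k) <= C / (1 - r) * r ^+ N.
  by rewrite exprD mulrA ler_piMr ?exprn_ile1// ltW.
rewrite -[leRHS]mulrA ler_pM2l// exprS.
have /eqP E : C == C / (1 - r) * (1 - r) by rewrite divfK// lt0r_neq0.
have := aC (N + k)%N; rewrite {1}E; move: (pos (N + k)%N) vu CN; rewrite !mulrBr.
set u := _ * r ^+ N; set v := _ * r ^+ (N + k).
have -> : C / (1 - r) * (r * r ^+ (N + k)) = r * v by rewrite /v; ring.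
have -> : (C / (1 - r) * 1 - C / (1 - r) * r) * r ^+ (N + k) = (1 - r) * v.
  by rewrite /v; ring.
move=> v0 vu u2 av.
(* This is (1 - x)(1 - y) >= 1 - x - y with x = u - v and y = (1 - r) v; the next inequality is the
   discarded term x y >= 0. *)
have : 0 <= (1 - (u - v)) * (a (N + k)%N - (1 - (1 - r) * v)).
  by rewrite mulr_ge0//; lra.
have : 0 <= (1 - r) * v * (u - v) by apply: mulr_ge0; [apply: mulr_ge0|]; lra.
nra.
Qed.

(** Up to sign, cos (pi alpha^j) depends only on the offset of alpha^j from an integer, which decays
    geometrically. *)
Lemma pisot_cos_prod_lower_bound (R : realType) (alpha : R) : pisot alpha ->
  exists2 c, 0 < c & forall n, c <= \prod_(j < n) `|cos (pi * alpha ^+ j)|.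
Proof.
move=> ap; have [C [r [C0 r01 near]]] := pisot_pow_near_int ap.
have pi0 := @pi_gt0 R.
apply: (@prod_lower_bound R (fun j => `|cos (pi * alpha ^+ j)|) (pi * C) r) => // [|j|j].
- by rewrite mulr_ge0// ltW.
- rewrite cos_max normr_gt0 andbT; case: j => [|j].
    (* For j = 0 the power is 1, which is rational, but the cosine is -1. *)
    by rewrite expr0 mulr1 cospi oppr_eq0 oner_eq0.
  by rewrite cos_pi_neq0//; exact: pisot_pow_irrational.
- have [k kj] := near j.
  have -> : cos (pi * alpha ^+ j) = cos (pi * (alpha ^+ j - k%:~R) + k%:~R * pi).
    by congr cos; ring.
  rewrite norm_cosDpiz lerBlDr -lerBlDl.
  rewrite (le_trans _ (norm_cos_ge _))// lerB// normrM gtr0_norm// -mulrA.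
  by rewrite ler_pM2l.
Qed.

(** * Total variation and self-similar measures *)

Section BoundedIntegrals.
Context d (T : measurableType d) (R : realType).
Variables (f : T -> R) (f_meas : measurable_fun setT f).
Hypothesis f_le1 : forall x, `|f x| <= 1.

Lemma le1_integrable (mu : {finite_measure set T -> \bar R}) :
  mu.-integrable setT (EFin \o f).
Proof.
apply: measurable_bounded_integrable => //; first exact: fin_num_fun_lty.
by exists 1; split=> // M M1 x _; exact: le_trans (f_le1 x) (ltW M1).
Qed.

Lemma norm_Rintegral_le1 (mu : {finite_measure set T -> \bar R}) :
  `|\int[mu]_x f x| <= fine (mu setT).
Proof.
rewrite (le_trans (le_normr_Rintegral _ (le1_integrable mu)))//.
rewrite -[leRHS]mul1r -Rintegral_cst//; apply: le_Rintegral => //.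
  exact/integrable_norm/le1_integrable.
exact: finite_measure_integrable_cst.
Qed.

Lemma Rintegral_measure_add (mu nu : {finite_measure set T -> \bar R}) :
  \int[measure_add mu nu]_x f x = \int[mu]_x f x + \int[nu]_x f x.
Proof.
have mf : measurable_fun setT (EFin \o f) by exact/measurable_EFinP.
have imu := le1_integrable mu; have inu := le1_integrable nu.
by rewrite /Rintegral (integral_measure_add _ imu inu)// fineD//;
  exact: integrable_fin_num.
Qed.

(** The Jordan decomposition mu - nu = jp - jn is rearranged as mu + jn = nu + jp, so that only
    positive measures are integrated; the difference of integrals is then at most jp(T) + jn(T). *)
Lemma tv_dist_ge (mu nu : probability T R) :
  (`|\int[mu]_x f x - \int[nu]_x f x|%:E <= tv_dist mu nu)%E.
Proof.
rewrite /tv_dist /tv_norm; set hahn := (X in charge_variation X).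
rewrite /charge_variation.
set jp := jordan_pos hahn; set jn := jordan_neg hahn.
have eqA A : measurable A -> measure_add mu jn A = measure_add nu jp A.
  move=> mA; rewrite !measure_addE; have := jordan_decomp hahn mA.
  rewrite /cadd /= cscaleN1 -/jp -/jn => E.
  have {E} : (mu A - nu A = jp A - jn A)%E by [].
  rewrite -[mu A]fineK ?fin_num_measure// -[nu A]fineK ?fin_num_measure//.
  rewrite -[jp A]fineK ?fin_num_measure// -[jn A]fineK ?fin_num_measure//.
  by rewrite -!EFinB -!EFinD => -[E]; congr EFin; lra.
have : \int[measure_add mu jn]_x f x = \int[measure_add nu jp]_x f x.
  by rewrite /Rintegral; congr fine; apply: eq_measure_integral => A mA _; exact: eqA.
rewrite !Rintegral_measure_add => E.
have -> : \int[mu]_x f x - \int[nu]_x f x = \int[jp]_x f x - \int[jn]_x f x.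
  by lra.
rewrite -[jp setT]fineK ?fin_num_measure// -[jn setT]fineK ?fin_num_measure//.
rewrite -EFinD lee_fin (le_trans (ler_normB _ _))//.
by rewrite lerD ?norm_Rintegral_le1.
Qed.

End BoundedIntegrals.

Lemma measurable_tau (R : realType) (A b : R) :
  measurable_fun setT (tau A b : measurableTypeR R -> measurableTypeR R).
Proof.
apply: continuous_measurable_fun => x; apply: cvgMr.
by apply: cvgD; [exact: cvg_id|exact: cvg_cst].
Qed.

Definition mfun_of d d' (T : measurableType d) (T' : measurableType d')
    (f : T -> T') (mf : measurable_fun setT f) : {mfun T >-> T'} :=
  MeasurableFun.Pack (MeasurableFun.Class (isMeasurableFun.Build _ _ _ _ f mf)).

Lemma measurable_cos_affine (R : realType) (a b : R) :
  measurable_fun setT (fun x : measurableTypeR R => cos (a * (x - b))).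
Proof.
apply: continuous_measurable_fun => x.
apply: continuous_comp; last exact: continuous_cos.
by apply: cvgMr; apply: cvgB; [exact: cvg_id|exact: cvg_cst].
Qed.

(** * The recentred cosine transform of an invariant measure *)

Section CosineTransform.
Variables (R : realType) (alpha : R).
Hypothesis alpha_gt1 : 1 < alpha.
Local Notation borel_probability := (probability (measurableTypeR R) R).
Local Notation digits t := (translated_digits alpha [fset 0; 1] t).

Let alpha_gt0 : 0 < alpha. Proof. exact: lt_trans alpha_gt1. Qed.
Let alpha_neq0 : alpha != 0. Proof. exact: lt0r_neq0. Qed.
Let alpha1_neq0 : alpha - 1 != 0.
Proof. by rewrite subr_eq0 gt_eqF. Qed.

Lemma translated_digits_invariantE t (mu : borel_probability) :
  is_invariant_measure alpha (digits t) mu <->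
  forall E : set (measurableTypeR R), measurable E ->
    (mu E = 2^-1%:E * (mu (tau alpha (alpha * t) @^-1` E)
                       + mu (tau alpha (1 + alpha * t) @^-1` E)))%E.
Proof.
have inj : injective (fun b => b + alpha * t) by exact: addIr.
have card2 : #|` digits t| = 2%N.
  by rewrite card_imfset//= cardfs2 eq_sym oner_eq0.
have sumE (F : R -> \bar R) :
    (\sum_(b <- digits t) F b = F (alpha * t)%R + F (1 + alpha * t)%R)%E.
  rewrite big_imfset/=; last by move=> x y _ _; exact: inj.
  by rewrite big_fsetU1 ?inE 1?eq_sym ?oner_eq0//= big_seq_fset1 add0r.
by rewrite /is_invariant_measure card2; split=> h E mE; rewrite [LHS]h// sumE.
Qed.

(** Doubling the invariance equation gives an equality of measures, mu + mu being the sum of the two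
    images of mu, which can be integrated directly. *)
Lemma Rintegral_invariant t (mu : borel_probability) (f : R -> R) :
  is_invariant_measure alpha (digits t) mu ->
  measurable_fun setT f -> (forall x, `|f x| <= 1) ->
  \int[mu]_x f x = 2^-1 * (\int[mu]_x f (tau alpha (alpha * t) x)
                           + \int[mu]_x f (tau alpha (1 + alpha * t) x)).
Proof.
rewrite translated_digits_invariantE => mu_inv fm f1.
pose m b : {finite_measure set (measurableTypeR R) -> \bar R} :=
  distribution mu (mfun_of (measurable_tau alpha b)).
have mE b : \int[m b]_x f x = \int[mu]_x f (tau alpha b x).
  have ftm : measurable_fun setT (f \o tau alpha b : measurableTypeR R -> R).
    by apply: measurableT_comp => //; exact: measurable_tau.
  have := le1_integrable ftm (fun x => f1 _) mu => int.
  by rewrite /Rintegral /m integral_distribution//; exact/measurable_EFinP.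
have : \int[measure_add mu mu]_x f x
    = \int[measure_add (m (alpha * t)) (m (1 + alpha * t))]_x f x.
  rewrite /Rintegral; congr fine; apply: eq_measure_integral => E mE' _.
  transitivity (mu E + mu E)%E; first exact: measure_addE.
  apply: etrans (esym (measure_addE _ _ _)); rewrite mu_inv// -ge0_muleDl//.
  rewrite -EFinD; have -> : 2^-1 + 2^-1 = 1 :> R by lra.
  by rewrite mul1e.
have fE m1 m2 := @Rintegral_measure_add _ (measurableTypeR R) R f fm f1 m1 m2.
move=> h; have := etrans (esym (fE _ _)) (etrans h (fE _ _)).
by rewrite !mE => {}h; lra.
Qed.

(* Centre of symmetry of the invariant measure of the digits [0 + alpha t]
   and [1 + alpha t]. *)
Definition centre t : R := (2^-1 + alpha * t) / (alpha - 1).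

(** Real part of the Fourier transform of mu recentred at [centre t]; the recentring removes the
    dependence on t. *)
Definition cosine_transform t (mu : borel_probability) (xi : R) : R :=
  \int[mu]_x cos (xi * (x - centre t)).

Let integrable_cos_affine (mu : borel_probability) (a b : R) :
  mu.-integrable setT (EFin \o (fun x : measurableTypeR R => cos (a * (x - b)))).
Proof.
exact: le1_integrable (measurable_cos_affine a b) (fun x => cos_max _) mu.
Qed.

Lemma cosine_transform_rec t (mu : borel_probability) xi :
  is_invariant_measure alpha (digits t) mu ->
  cosine_transform t mu xi =
  cos (xi / alpha / 2) * cosine_transform t mu (xi / alpha).
Proof.
move=> mu_inv; rewrite /cosine_transform (Rintegral_invariant mu_inv); first last.
- by move=> x; exact: cos_max.
- exact: measurable_cos_affine.
set c := centre t; set y := xi / alpha.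
(* The centre solves alpha c = c + 1/2 + alpha t, so the two maps give opposite offsets 1/2 and the
   sine terms cancel in the sum. *)
have E0 x : xi * (tau alpha (alpha * t) x - c) = y * (x - (c + 2^-1)).
  by rewrite /tau /y /c /centre; field; rewrite alpha_neq0 alpha1_neq0.
have E1 x : xi * (tau alpha (1 + alpha * t) x - c) = y * (x - (c - 2^-1)).
  by rewrite /tau /y /c /centre; field; rewrite alpha_neq0 alpha1_neq0.
under eq_Rintegral do rewrite E0.
under [X in _ + X]eq_Rintegral do rewrite E1.
rewrite -RintegralD//; [|exact: integrable_cos_affine..].
have E x : cos (y * (x - (c + 2^-1))) + cos (y * (x - (c - 2^-1)))
    = 2 * cos (y / 2) * cos (y * (x - c)).
  have -> : y * (x - (c + 2^-1)) = y * (x - c) - y / 2 by ring.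
  have -> : y * (x - (c - 2^-1)) = y * (x - c) + y / 2 by ring.
  by rewrite cosB cosD; ring.
under eq_Rintegral do rewrite E.
rewrite RintegralZl//; last exact: integrable_cos_affine.
by rewrite -mulrA mulKf.
Qed.

(** Dominated convergence with bound 1: the frequencies tend to 0 and mu has mass 1. *)
Lemma cosine_transform_cvg t (mu : borel_probability) xi :
  (fun n => cosine_transform t mu (xi / alpha ^+ n)) @ \oo --> (1 : R).
Proof.
pose f n (x : measurableTypeR R) := cos (xi / alpha ^+ n * (x - centre t)).
have lim1 (x : measurableTypeR R) : f n x @[n --> \oo] --> (1 : R).
  rewrite -[X in _ --> X](@cos0 R); apply: continuous_cvg; first exact: continuous_cos.
  rewrite -[X in _ --> X](mul0r (x - centre t)); apply: cvgMl.
  rewrite -[X in _ --> X](mulr0 xi); apply: cvgMr.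
  under eq_fun do rewrite -exprVn.
  by apply: cvg_expr; rewrite gtr0_norm ?invr_gt0// invf_lt1.
apply: fine_cvg.
have <- : (\int[mu]_x (cst 1%:E) x = 1%:E)%E.
  by rewrite integral_cst// mul1e; exact: probability_setT.
apply: (@dominated_cvg _ _ _ mu setT measurableT (fun n => EFin \o f n) (cst 1%:E)
    (cst 1%:E)) => //=.
  - by move=> n; exact: measurable_int (integrable_cos_affine mu _ _).
  - by move=> x _; apply: cvg_comp (lim1 x) _; exact: cvg_id.
  - by apply: finite_measure_integrable_cst.
  - by move=> n x _; rewrite lee_fin cos_max.
Qed.

Lemma cosine_transform_prod t (mu : borel_probability) xi n :
  is_invariant_measure alpha (digits t) mu ->
  cosine_transform t mu xi = \prod_(j < n) cos (xi / alpha ^+ j.+1 / 2)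
    * cosine_transform t mu (xi / alpha ^+ n).
Proof.
move=> mu_inv; elim: n => [|n IH].
  by rewrite big_ord0 mul1r expr0 divr1.
rewrite big_ord_recr /= IH (cosine_transform_rec (xi / alpha ^+ n) mu_inv) mulrA.
by rewrite exprSr invfM mulrA.
Qed.

(** Both transforms carry the same cosine product, of modulus at most 1, so their gap at xi is at
    most their gap at xi / alpha^n, which tends to 0. *)
Lemma cosine_transform_unique t s (mu nu : borel_probability) xi :
  is_invariant_measure alpha (digits t) mu ->
  is_invariant_measure alpha (digits s) nu ->
  cosine_transform t mu xi = cosine_transform s nu xi.
Proof.
move=> mu_inv nu_inv; apply/eqP; rewrite -subr_eq0 -normr_le0.
have lim0 : (fun n => `|cosine_transform t mu (xi / alpha ^+ n)
                  - cosine_transform s nu (xi / alpha ^+ n)|) @ \oo --> `|1 - 1 : R|.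
  by apply: cvg_norm; apply: cvgB; exact: cosine_transform_cvg.
rewrite subrr normr0 in lim0.
apply: (ler_cvg_to (cvg_cst _) lim0); apply: nearW => n.
rewrite (cosine_transform_prod xi n mu_inv) (cosine_transform_prod xi n nu_inv).
rewrite -mulrBr normrM ler_piMl// normr_prod.
by apply: prodr_ile1 => j _; rewrite normr_ge0 cos_max.
Qed.

End CosineTransform.

(** * Existence of the invariant measure *)

Section FairCoins.
Variable R : realType.
Local Notation leb := (@lebesgue_measure R).

Let half (c x : R) : R := (x + c) / 2.

Let measurable_half c :
  measurable_fun setT (half c : measurableTypeR R -> measurableTypeR R).
Proof.
apply: continuous_measurable_fun => x; apply: cvgMl.
by apply: cvgD; [exact: cvg_id|exact: cvg_cst].
Qed.

(** The right-hand side is a measure in E, so by uniqueness of Lebesgue measure half-open intervals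
    suffice. *)
Lemma lebesgue_measure_half c (E : set (measurableTypeR R)) :
  measurable E -> (leb E = 2^-1%:E * leb (half c @^-1` E))%E.
Proof.
have half0 : 0 <= 2^-1 :> R by rewrite invr_ge0.
pose push : {measure set (measurableTypeR R) -> \bar R} :=
  mscale (NngNum half0)
    (pushforward leb (half c : measurableTypeR R -> measurableTypeR R)).
move=> mE; rewrite (_ : (_ * _)%E = push (@measurable_half c) E)//.
apply: lebesgue_measure_unique mE => _ [[a b] _ <-].
suff : leb `]a, b] = (2^-1%:E * leb (half c @^-1` `]a, b]))%E by [].
have -> : half c @^-1` `]a, b] = `]2 * a - c, 2 * b - c]%classic.
  apply/seteqP; split => x /=; rewrite !in_itv /= /half => /andP[? ?];
    by apply/andP; split; lra.
rewrite !lebesgue_measure_itv /= !lte_fin.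
have -> : (2 * a - c < 2 * b - c) = (a < b) by apply/idP/idP; lra.
by case: ifP => _; rewrite ?mule0// -!EFinB -EFinM; congr EFin; lra.
Qed.

Let unit_itv : set (measurableTypeR R) := `[0, 1[%classic.

Let measurable_unit_itv : measurable unit_itv.
Proof. exact: measurable_itv. Qed.

Definition unit_lebesgue : set (measurableTypeR R) -> \bar R :=
  mrestr leb measurable_unit_itv.

HB.instance Definition _ := Measure.on unit_lebesgue.

Let unit_lebesgue_setT : unit_lebesgue setT = 1%:E.
Proof.
rewrite /unit_lebesgue /mrestr setTI lebesgue_measure_itv /=.
by rewrite lte_fin ltr01 oppr0 adde0.
Qed.

HB.instance Definition _ :=
  Measure_isProbability.Build _ _ _ unit_lebesgue unit_lebesgue_setT.

(** The uniform law on [0, 1[ is itself self-similar: x / 2 and (x + 1) / 2 map [0, 1[ onto its two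
    disjoint halves. *)
Lemma unit_lebesgue_split (E : set (measurableTypeR R)) : measurable E ->
  (unit_lebesgue E = 2^-1%:E * (unit_lebesgue (half 0 @^-1` E)
                                + unit_lebesgue (half 1 @^-1` E)))%E.
Proof.
move=> mE; rewrite /unit_lebesgue /mrestr.
pose lower : set R := `[0, 2^-1[%classic; pose upper : set R := `[2^-1, 1[%classic.
have splitE : unit_itv = lower `|` upper :> set R.
  by rewrite -itv_bndbnd_setU// bnd_simp; lra.
have disj : lower `&` upper = set0.
  rewrite /lower /upper; apply/seteqP; split => // x [] /=.
  rewrite !in_itv /= => /andP[_ xh] /andP[hx _].
  by have := lt_le_trans xh hx; rewrite ltxx.
have half_itv c : half c @^-1` `[c / 2, (c + 1) / 2[ = unit_itv :> set R.
  rewrite /unit_itv; apply/seteqP; split => x /=; rewrite !in_itv /= /half;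
    by move=> /andP[? ?]; apply/andP; split; lra.
have ml : measurable (E `&` lower : set (measurableTypeR R)).
  by apply: measurableI => //; exact: measurable_itv.
have mu : measurable (E `&` upper : set (measurableTypeR R)).
  by apply: measurableI => //; exact: measurable_itv.
rewrite {1}splitE setIUr.
have -> : (leb (E `&` lower `|` E `&` upper)
    = leb (E `&` lower) + leb (E `&` upper))%E.
  by apply: measureU => //; rewrite setIACA disj setI0.
rewrite (lebesgue_measure_half 0 ml) (lebesgue_measure_half 1 mu).
rewrite -ge0_muleDr//; congr (_ * (leb _ + leb _))%E; rewrite preimage_setI.
  by have := half_itv 0; rewrite mul0r add0r div1r => ->.
by have := half_itv 1; rewrite (_ : (1 + 1) / 2 = 1) ?div1r => [->|]; last by field.
Qed.

(** * The random series with fair binary digits, and its law *)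

Variable alpha : R.
Hypothesis alpha_gt1 : 1 < alpha.
Let alpha_gt0 : 0 < alpha. Proof. exact: lt_trans alpha_gt1. Qed.

(* The binary digits of a uniform random point of [0, 1[ are fair coin flips. *)
Let digit (x : R) : R := (2^-1 <= x)%R%:R.
Let double (x : R) : R := 2 * x - digit x.

(** For x in [0, 1[ with binary digits d_j, this is the sum of d_j alpha^(-j) over 1 <= j <= n, in
    Horner form to match [tau]. *)
Let Fixpoint partial_sum n (x : R) : R :=
  if n is m.+1 then tau alpha (digit x) (partial_sum m (double x)) else 0.

Let measurable_digit : measurable_fun setT digit.
Proof.
have -> : digit = \1_(`[2^-1, +oo[%classic : set R).
  by apply/funext => x; rewrite /digit indicE mem_setE in_itv /= andbT.
by apply: measurable_indic; exact: measurable_itv.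
Qed.

Let measurable_double : measurable_fun setT double.
Proof.
by apply: measurable_funB => //; apply: measurable_funM.
Qed.

Let measurable_partial_sum n : measurable_fun setT (partial_sum n).
Proof.
elim: n => [|n IH] /=; first exact: measurable_cst.
apply: measurable_funM => //; apply: measurable_funD => //.
by apply: measurableT_comp IH _.
Qed.

Let partial_sum_le n x : 0 <= partial_sum n x <= partial_sum n.+1 x.
Proof.
elim: n x => [|n IH] x.
  by rewrite /= lexx /tau add0r mulr_ge0 ?invr_ge0 ?ler0n ?ltW.
rewrite [partial_sum n.+1 x]/= [partial_sum n.+2 x]/=.
have /andP[h0 h1] := IH (double x); rewrite /tau.
rewrite mulr_ge0 ?invr_ge0 ?(ltW alpha_gt0) ?addr_ge0 ?ler0n//.
by rewrite ler_pM2l ?invr_gt0// lerD2r.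
Qed.

(** The bound is the fixed point of [tau alpha 1], the value of the series when all digits are 1. *)
Let partial_sum_ub n x : partial_sum n x <= (alpha - 1)^-1.
Proof.
have a1 : 0 < alpha - 1 by rewrite subr_gt0.
elim: n x => [|n IH] x /=; first by rewrite invr_ge0 ltW.
rewrite /tau ler_pdivrMl//.
have -> : alpha * (alpha - 1)^-1 = (alpha - 1)^-1 + 1.
  by field; rewrite lt0r_neq0.
by rewrite lerD// /digit lern1 leq_b1.
Qed.

Let random_sum (x : R) : R :=
  limn (partial_sum ^~ x).

Let random_sum_cvg x : partial_sum n x @[n --> \oo] --> random_sum x.
Proof.
apply: nondecreasing_is_cvgn.
  by apply/nondecreasing_seqP => n; case/andP: (partial_sum_le n x).
by exists (alpha - 1)^-1 => _ [n _ <-]; exact: partial_sum_ub.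
Qed.

Let measurable_random_sum : measurable_fun setT random_sum.
Proof.
by apply: (measurable_fun_cvg measurable_partial_sum) => x _; exact: random_sum_cvg.
Qed.

Let random_sum_tau x : random_sum x = tau alpha (digit x) (random_sum (double x)).
Proof.
transitivity (limn (fun n => partial_sum n.+1 x)).
  apply/esym/cvg_lim => //.
  by rewrite (cvg_shiftS (partial_sum ^~ x)); exact: random_sum_cvg.
apply/cvg_lim => //=; apply: cvgMr.
by apply: cvgD; [exact: random_sum_cvg|exact: cvg_cst].
Qed.

(** Adding alpha t to every digit adds alpha t times the sum of all alpha^(-j), j >= 1, which is 1 /
    (alpha - 1). *)
Let translated_sum t (x : R) : R :=
  random_sum x + alpha * t / (alpha - 1).

Let measurable_translated_sum t : measurable_fun setT
  (translated_sum t : measurableTypeR R -> measurableTypeR R).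
Proof. by apply: measurable_funD. Qed.

(** The point (x + b) / 2 has first binary digit b, followed by the digits of x; x < 1 is what makes
    the first digit 0 when b is 0. *)
Let translated_sum_half t (b : bool) x : 0 <= x < 1 ->
  translated_sum t (half b%:R x) = tau alpha (b%:R + alpha * t) (translated_sum t x).
Proof.
move=> /andP[x0 x1]; rewrite /translated_sum random_sum_tau.
have db : digit (half b%:R x) = b%:R.
  rewrite /digit /half; congr (nat_of_bool _)%:R.
  by case: b => /=; [|apply/negbTE; rewrite -ltNge]; lra.
have -> : double (half b%:R x) = x by rewrite /double db /half; field.
have an0 := lt0r_neq0 alpha_gt0.
by rewrite db /tau; field; rewrite an0 subr_eq0 gt_eqF.
Qed.

(** The law of [translated_sum] under the uniform law works: the halving maps that split the uniform
    law become the maps [tau]. *)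
Lemma invariant_measure_exists t : exists mu : probability (measurableTypeR R) R,
  is_invariant_measure alpha (translated_digits alpha [fset 0; 1] t) mu.
Proof.
exists (distribution unit_lebesgue (mfun_of (@measurable_translated_sum t))).
apply/translated_digits_invariantE => E mE; rewrite /distribution /pushforward /=.
have mS : measurable (translated_sum t @^-1` E : set (measurableTypeR R)).
  by rewrite -[X in measurable X]setTI; exact: measurable_translated_sum.
rewrite (unit_lebesgue_split mS).
have halfE (b : bool) :
    unit_lebesgue (half b%:R @^-1` (translated_sum t @^-1` E)) =
    unit_lebesgue (translated_sum t @^-1` (tau alpha (b%:R + alpha * t) @^-1` E)).
  rewrite /unit_lebesgue /mrestr; congr (leb _).
  apply/seteqP; split => x /= [xE]; rewrite /unit_itv /= in_itv /= => x01.
    by split=> //; rewrite -translated_sum_half.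
  by split=> //; rewrite translated_sum_half.
by rewrite -[0]/(false%:R) -[1]/(true%:R) !halfE /= add0r.
Qed.

End FairCoins.

(** * Chaos *)

Section Chaos.
Variables (R : realType) (alpha : R).
Hypothesis alpha_pisot : pisot alpha.
Local Notation borel_probability := (probability (measurableTypeR R) R).
Local Notation digits t := (translated_digits alpha [fset 0; 1] t).

Let alpha_gt1 : 1 < alpha. Proof. by case: alpha_pisot. Qed.
Let alpha_gt0 : 0 < alpha. Proof. exact: lt_trans alpha_gt1. Qed.
Let alpha_neq0 : alpha != 0. Proof. exact: lt0r_neq0. Qed.

Let cos_pi_div_neq0 n : cos (pi / alpha ^+ n.+1) != 0.
Proof.
apply: cos_pi_neq0 => -[q _ qE].
apply: (pisot_pow_irrational alpha_pisot (ltn0Sn n)); exists q^-1 => //.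
by rewrite fmorphV /= qE invrK.
Qed.

(** For large n the transform at 2 pi / alpha^n is within 1 of 1, hence nonzero; the n cosine
    factors relating it to 2 pi are nonzero by irrationality. *)
Let cosine_transform_2pi_neq0 t (mu : borel_probability) :
  is_invariant_measure alpha (digits t) mu ->
  cosine_transform alpha t mu (2 * pi) != 0.
Proof.
move=> mu_inv.
have /cvgrPdist_lt/(_ 1 ltr01)[n _ /(_ n (leqnn n)) /= near1] :=
  cosine_transform_cvg alpha_gt1 t mu (2 * pi).
rewrite (cosine_transform_prod alpha_gt1 _ n mu_inv) mulf_neq0//.
  apply/prodf_neq0 => j _.
  have -> : 2 * pi / alpha ^+ j.+1 / 2 = pi / alpha ^+ j.+1.
    by field; rewrite expf_neq0.
  exact: cos_pi_div_neq0.
by apply: contraTneq near1 => ->; rewrite subr0 normr1 ltxx.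
Qed.

Let norm_cosine_transform_pow t (mu : borel_probability) n :
  is_invariant_measure alpha (digits t) mu ->
  `|cosine_transform alpha t mu (2 * pi * alpha ^+ n)| =
  \prod_(j < n) `|cos (pi * alpha ^+ j)| * `|cosine_transform alpha t mu (2 * pi)|.
Proof.
move=> mu_inv; elim: n => [|n IH]; first by rewrite big_ord0 mul1r expr0 mulr1.
rewrite (cosine_transform_rec alpha_gt1 _ mu_inv) normrM big_ord_recr /=.
have -> : 2 * pi * alpha ^+ n.+1 / alpha = 2 * pi * alpha ^+ n.
  by rewrite exprSr mulrA mulfK.
have -> : 2 * pi * alpha ^+ n / 2 = pi * alpha ^+ n by field.
by rewrite IH mulrA [_ * `|cos _|]mulrC.
Qed.

(** Existence rules out the default Dirac mass. *)
Let invariant_measureP t :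
  is_invariant_measure alpha (digits t) (invariant_measure alpha (digits t)).
Proof.
by rewrite /invariant_measure; apply: xgetPex; exact: invariant_measure_exists.
Qed.

Let digits0 : digits 0 = [fset 0; 1].
Proof.
rewrite /translated_digits mulr0.
apply/fsetP => x; apply/imfsetP/idP => [[y yB ->]|xB]; first by rewrite addr0.
by exists x; rewrite ?addr0.
Qed.

(* For this translation the function cos (2 pi alpha^n (x - centre 0)) changes
   sign. *)
Let shift n : R := (alpha - 1) / (2 * alpha) / alpha ^+ n.

Let shift_cvg : shift @ \oo --> 0.
Proof.
rewrite -[X in _ --> X](mulr0 ((alpha - 1) / (2 * alpha))); apply: cvgMr.
under eq_fun do rewrite -exprVn.
by apply: cvg_expr; rewrite gtr0_norm ?invr_gt0// invf_lt1.
Qed.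

Lemma pisot_chaotic : chaotic alpha [fset 0; 1].
Proof.
have [c c0 cP] := pisot_cos_prod_lower_bound alpha_pisot.
have mu0 := invariant_measureP 0; set mu := invariant_measure _ _ in mu0.
have F0 := cosine_transform_2pi_neq0 mu0.
exists shift, (2 * (c * `|cosine_transform alpha 0 mu (2 * pi)|)); split.
- exact: shift_cvg.
- by rewrite !mulr_gt0// normr_gt0.
move=> n; rewrite -{2}digits0 -/mu.
have nu_inv := invariant_measureP (shift n).
set nu := invariant_measure _ _ in nu_inv *.
set xi := 2 * pi * alpha ^+ n.
pose f (x : measurableTypeR R) := cos (xi * (x - centre alpha 0)).
apply: le_trans (tv_dist_ge (measurable_cos_affine _ _ : measurable_fun setT f)
  (fun x => cos_max _) nu mu).
have -> : \int[mu]_x f x = cosine_transform alpha 0 mu xi by [].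
have -> : \int[nu]_x f x = - cosine_transform alpha 0 mu xi.
  (* The transform of [mu] equals that of [nu] about its own centre; moving back to [centre alpha 0]
     adds xi (c_t - c_0) = pi to the argument and flips the sign. *)
  rewrite (cosine_transform_unique alpha_gt1 xi mu0 nu_inv) /cosine_transform.
  rewrite -mulN1r -RintegralZl//; last first.
    exact: le1_integrable (measurable_cos_affine _ _) (fun x => cos_max _) nu.
  apply: eq_Rintegral => x _; rewrite mulN1r -cosDpi /f; congr cos.
  rewrite /xi /centre /shift; field.
  by rewrite expf_neq0// alpha_neq0 subr_eq0 gt_eqF.
set F := cosine_transform _ _ _ xi.
rewrite lee_fin (_ : - F - F = - (2 * F)); last by ring.
rewrite normrN normrM ger0_norm//.
by rewrite ler_pM2l// norm_cosine_transform_pow// ler_wpM2r.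
Qed.

End Chaos.

Theorem theorem3p27 (R : realType) (alpha lambda : R)
  (hpisot : pisot alpha) (hlambda : lambda = alpha^-1) :
  chaotic lambda^-1 [fset 0; 1].
Proof. by rewrite hlambda invrK; exact: pisot_chaotic. Qed.
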